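(* Let $(G,\omega)$ be a decorated planar graph of nilpotency degree zero. Then each connected component of $\mathcal{L}(G,\omega)$ is the directed graph of a finite graded distributive lattice. More precisely, for every $\omega$-compatible angular function $f$ for $(G,\omega)$ there exists an $\omega$-compatible angular function $f_-$ for $(G,\omega)$ such that the forgetful map $$\pi\colon \mathrm{BMS}^+(G,\omega;f_-)\to \mathcal{L}(G,\omega),\qquad (f_+,f_-,d)\mapsto f_+$$ induces an isomorphism of directed graphs $\mathrm{BMS}^+(G,\omega;f_-)\to \mathcal{L}(G,\omega)_f$, where $\mathcal{L}(G,\omega)_f$ denotes the connected component of $f$ in $\mathcal{L}(G,\omega)$.
   Context: **Planar graphs.** $G=(V_G,E_G)$ is a finite connected undirected multigraph (multiple edges allowed) without loops, with every vertex of degree $\ge 2$, embedded in the oriented sphere $S^2$; $F_G$ is its set of faces. An angle at a vertex $v$ is a pair of half-edges at $v$ that are consecutive in the clockwise cyclic order around $v$; it is oriented clockwise, from its source edge $s(a)$ to its target edge $t(a)$ (the next edge clockwise), and lies in one face. $A_G$ is the set of angles. Every edge is the source of exactly two angles and the target of exactly two angles. The directed medial graph $\mathcal{Q}G$ has vertex set $E_G$ and one arrow $s(a)\to t(a)$ for each $a\in A_G$; $|\mathcal{Q}G|$ is its geometric realization, a 1-dimensional CW complex. **Weights.** A weight is a class $\omega\in H^1(|\mathcal{Q}G|;\mathbb{Z})$, and $(G,\omega)$ is called a decorated planar graph. An angular function is a map $g\colon A_G\to\mathbb{Z}_{\ge0}$; it is $\omega$-compatible if, viewed as a cellular 1-cochain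 of $|\mathcal{Q}G|$, it represents $\omega$. $\mathcal{L}(G,\omega)$ is the set of $\omega$-compatible angular functions. **Moves.** For $\epsilon\colon E_G\to\mathbb{Z}$ let $(\delta\epsilon)(a)=\epsilon(t(a))-\epsilon(s(a))$; $\chi_e$ is the characteristic function of $e\in E_G$. $g\in\mathcal{L}(G,\omega)$ is $e$-movable if $g+\delta\chi_e\ge0$ on $A_G$; then $\mathrm{mov}_e(g)=g+\delta\chi_e\in\mathcal{L}(G,\omega)$. $\mathcal{L}(G,\omega)$ is a directed graph: there is an edge $g\to\mathrm{mov}_e(g)$ for each $e$ such that $g$ is $e$-movable. Connected components are those of the underlying undirected graph. **Nilpotency degree.** An angular cycle is a cellular 1-cycle of $|\mathcal{Q}G|$ with non-negative coefficients in the basis of arrows; $\lambda_\omega(c)\in\mathbb{Z}$ is the value of $\omega$ on the class of $c$ (so $\lambda_\omega(c)=\sum_a c_a g(a)$ for any $\omega$-compatible $g$). $(G,\omega)$ has nilpotency degree zero if $\min\{\lambda_\omega(c): c\text{ a non-zero angular cycle}\}=0$. An invisible angular cycle is a non-zero angular cycle with $\lambda_\omega(c)=0$; it is connected if the arrows with non-zero coefficient form a connected subgraph of $\mathcal{Q}G$. **BMS states.** A dimension vector is a map $d\colon E_G\to\mathbb{Z}_{\ge0}$. A weak BMS state is a triple $(f_+,f_-,d)$ with $f_\pm\in\mathcal{L}(G,\omega)$, $d$ a dimension vector and $f_+=f_-+\delta d$. It is a BMS state if $d(e)=0$ for every edge $e$ belonging to a connected invisible angular cycle. $\mathrm{BMS}(G,\omega)$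 is the directed graph whose vertices are the BMS states, with an edge from $(f_+,f_-,d)$ to $(f_++\delta\chi_e,f_-,d+\chi_e)$ for each $e\in E_G$ such that $f_+$ is $e$-movable. For $g\in\mathcal{L}(G,\omega)$, $\mathrm{BMS}^+(G,\omega;g)$ is the full subgraph on the BMS states with $f_-=g$. **Convention.** A directed graph is ''the directed graph of a (graded distributive) lattice'' if the relation ''$x\le y$ iff there is a directed path from $x$ to $y$'' is a partial order making its vertex set a (distributive) lattice; graded means that there is an integer-valued rank function increasing by $1$ along each directed edge. *)

(* Defs.v *)
From HB Require Import structures.
From mathcomp Require Import all_boot all_order all_algebra.
From mathcomp Require Import boolp classical_sets.

Set Implicit Arguments.
Unset Strict Implicit.
Unset Printing Implicit Defensive.

Import Order.TTheory GRing.Theory Num.Theory.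
Local Open Scope classical_set_scope.
Local Open Scope ring_scope.
Local Open Scope quotient_scope.

(* A connected multigraph embedded in the oriented sphere, given by its
   rotation system: [opp] exchanges the two half-edges of an edge, and [next]
   sends a half-edge to the clockwise next one around the same vertex.  The
   faces are the orbits of [next \o opp], and Euler's formula says that the
   resulting surface is a sphere. *)
Record planar_graph := PlanarGraph {
  vertex : finType;
  edge : finType;
  half : finType;
  endpoint : half -> vertex;
  edge_of : half -> edge;
  opp : half -> half;
  next : half -> half;
  edge_of_surj : forall e : edge, exists h : half, edge_of h = e;
  edge_of_fiber : forall h h' : half,
    (edge_of h == edge_of h') = (h' == h) || (h' == opp h);
  opp_neq : forall h : half, opp h != h;
  oppK : involutive opp;
  next_inj : injective next;
  next_orbit : forall h h' : half,
    fconnect next h h' = (endpoint h == endpoint h');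
  loopless : forall h : half, endpoint (opp h) != endpoint h;
  degree_ge2 : forall v : vertex, (2 <= #|[set h | endpoint h == v]|)%N;
  graph_connected : forall u v : vertex,
    connect [rel x y | [exists h, (endpoint h == x) && (endpoint (opp h) == y)]]
      u v;
  euler_sphere :
    (#|vertex| + fcard (next \o opp) (half : predArgType) = #|edge| + 2)%N
}.

(* The angle (h, next h) is encoded by its source half-edge h. *)
Definition angle (G : planar_graph) : finType := half G.
Definition source (G : planar_graph) (a : angle G) : edge G := edge_of a.
Definition target (G : planar_graph) (a : angle G) : edge G := edge_of (next a).

(* Cellular (co)chains of the directed medial graph, whose vertices are the
   edges of G and whose arrows are the angles of G. *)
Notation cochain0 G := {ffun edge G -> int}.
Notation cochain1 G := {ffun angle G -> int}.
Notation chain0 G := {ffun edge G -> int}.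
Notation chain1 G := {ffun angle G -> int}.

Definition delta (G : planar_graph) (eps : cochain0 G) : cochain1 G :=
  [ffun a => eps (target a) - eps (source a)].

Definition chi (G : planar_graph) (e : edge G) : cochain0 G :=
  [ffun e' => (e' == e)%:R].

Definition boundary (G : planar_graph) (c : chain1 G) : chain0 G :=
  [ffun e => \sum_(a | target a == e) c a - \sum_(a | source a == e) c a].

Definition nonneg (G : planar_graph) (g : {ffun angle G -> int}) : bool :=
  [forall a, 0 <= g a].

Definition coboundary (G : planar_graph) : {pred cochain1 G} :=
  [pred g | `[< exists eps : cochain0 G, g = delta eps >]].

Lemma deltaB (G : planar_graph) (e1 e2 : cochain0 G) :
  delta (e1 - e2) = delta e1 - delta e2.
Proof. by apply/ffunP => a; rewrite !ffunE !opprD addrACA. Qed.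

Lemma coboundary_zmod_closed (G : planar_graph) : zmod_closed (@coboundary G).
Proof.
split=> [|g h /asboolP[e1 ->] /asboolP[e2 ->]]; apply/asboolP.
  by exists 0; apply/ffunP => a; rewrite !ffunE subrr.
by exists (e1 - e2); rewrite deltaB.
Qed.

HB.instance Definition _ (G : planar_graph) :=
  GRing.isZmodClosed.Build (cochain1 G) (@coboundary G)
    (@coboundary_zmod_closed G).

(* Cohomology of a graph seen as a 1-dimensional complex: every 1-cochain is a
   cocycle.  A weight is an element of [H1 G]. *)
Definition H1 (G : planar_graph) : zmodType :=
  Quotient.quot (@coboundary G : zmodClosed (cochain1 G)).

Definition coh_class (G : planar_graph) (g : cochain1 G) : H1 G :=
  \pi_(Quotient.quot (@coboundary G : zmodClosed (cochain1 G))) g.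

Lemma coh_class_eqP (G : planar_graph) (g h : cochain1 G) :
  coh_class g = coh_class h <-> exists eps : cochain0 G, g = h + delta eps.
Proof.
rewrite /coh_class; split.
  move/eqP; rewrite piE /= Quotient.equivE => /asboolP[eps gh].
  by exists eps; rewrite -gh addrC subrK.
move=> [eps ->]; apply/eqP; rewrite piE /= Quotient.equivE addrC addKr.
by apply/asboolP; exists eps.
Qed.

(* The evaluation of a cohomology class on a 1-cycle; it does not depend on the
   representative [repr w], see [lambdaE]. *)
Definition lambda (G : planar_graph) (w : H1 G) (c : chain1 G) : int :=
  \sum_a c a * repr w a.

Lemma lambdaE (G : planar_graph) (w : H1 G) (c : chain1 G)
    (g : cochain1 G) :
  boundary c = 0 -> coh_class g = w -> lambda w c = \sum_a c a * g a.
Proof.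
move=> c0 gw; rewrite /lambda.
have /coh_class_eqP[eps ->] : coh_class (repr w) = coh_class g
  by rewrite gw /coh_class reprK.
under eq_bigr do rewrite ffunE mulrDr.
rewrite big_split /= -[RHS]addr0; congr (_ + _).
under eq_bigr do rewrite ffunE mulrBr.
rewrite sumrB (partition_big (@target G) xpredT) //=.
rewrite [X in _ - X](partition_big (@source G) xpredT) //=.
rewrite -sumrB big1 // => e _; move/ffunP/(_ e): c0; rewrite !ffunE => c0.
rewrite (eq_bigr (fun a => c a * eps e)); last by move=> a /eqP ->.
rewrite [X in _ - X](eq_bigr (fun a => c a * eps e)); last by move=> a /eqP ->.
by rewrite -!mulr_suml -mulrBl c0 mul0r.
Qed.

Definition angular_cycle (G : planar_graph) (c : chain1 G) : Prop :=
  boundary c = 0 /\ nonneg c.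

(* The minimum of the values of w on non-zero angular cycles exists and is 0. *)
Definition nilpotency_degree_zero (G : planar_graph) (w : H1 G) : Prop :=
  (exists c : chain1 G, [/\ angular_cycle c, c != 0 & lambda w c = 0]) /\
  (forall c : chain1 G, angular_cycle c -> c != 0 -> 0 <= lambda w c).

Definition invisible_cycle (G : planar_graph) (w : H1 G) (c : chain1 G) :
    Prop :=
  [/\ angular_cycle c, c != 0 & lambda w c = 0].

(* The vertices of the subgraph of the medial graph formed by the arrows with
   non-zero coefficient in c and their ends. *)
Definition belongs_to (G : planar_graph) (e : edge G) (c : chain1 G) : bool :=
  [exists a, (c a != 0) && ((source a == e) || (target a == e))].

Definition connected_cycle (G : planar_graph) (c : chain1 G) : Prop :=
  forall e e' : edge G, belongs_to e c -> belongs_to e' c ->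
  connect [rel x y | [exists a, (c a != 0) &&
             (((source a == x) && (target a == y)) ||
              ((source a == y) && (target a == x)))]] e e'.

(* A relation is enough: the medial graph of a connected graph is connected and
   loopless, so distinct edges of G have distinct nonzero [delta (chi e)] and the
   directed graphs below have no parallel arrows. *)
Record digraph := Digraph {
  dvertex :> Type;
  arrow : rel dvertex
}.

Definition dpath (D : digraph) (x y : D) : Prop :=
  exists2 p : seq D, path (@arrow D) x p & y = last x p.

Definition component (D : digraph) (x : D) : set D :=
  [set y | exists2 p : seq D,
    path [rel u v | arrow u v || arrow v u] x p & y = last x p].

Definition full_subgraph (D : digraph) (A : set D) : digraph :=
  @Digraph A (fun x y => arrow (val x) (val y)).

Definition digraph_iso (D D' : digraph) (phi : D -> D') : Prop :=
  bijective phi /\ (forall x y : D, arrow x y = arrow (phi x) (phi y)).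

(* Reachability by directed paths makes the vertex set a finite distributive
   lattice, and arrows increase an integer-valued rank function by 1. *)
Definition is_finite_graded_distr_lattice (D : digraph) : Prop :=
  (exists (disp : Order.disp_t) (T : finDistrLatticeType disp) (phi : T -> D),
     bijective phi /\ (forall s t : T, (s <= t)%O <-> dpath (phi s) (phi t))) /\
  (exists rk : D -> int, forall x y : D, arrow x y -> rk y = rk x + 1).

Definition compatible (G : planar_graph) (w : H1 G) : Type :=
  {g : cochain1 G | nonneg g && (coh_class g == w)}.

Definition movable (G : planar_graph) (e : edge G) (g : cochain1 G) : bool :=
  nonneg (g + delta (chi e)).

Definition mov (G : planar_graph) (e : edge G) (g : cochain1 G) : cochain1 G :=
  g + delta (chi e).

Definition Lgraph (G : planar_graph) (w : H1 G) : digraph :=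
  @Digraph (compatible w)
    (fun g g' => [exists e, movable e (val g) && (val g' == mov e (val g))]).

Record bms_state (G : planar_graph) (w : H1 G) := BMSState {
  fplus : compatible w;
  fminus : compatible w;
  dimv : {ffun edge G -> nat};
  bms_weak : val fplus = val fminus + delta [ffun e => (dimv e)%:Z];
  bms_vanish : forall (e : edge G) (c : chain1 G),
    invisible_cycle w c -> connected_cycle c -> belongs_to e c -> dimv e = 0%N
}.

Definition BMSgraph (G : planar_graph) (w : H1 G) : digraph :=
  @Digraph (bms_state w)
    (fun x y => [exists e, [&& movable e (val (fplus x)),
       val (fplus y) == mov e (val (fplus x)),
       val (fminus y) == val (fminus x) &
       dimv y == [ffun e' => (dimv x e' + (e' == e))%N]]]).

Definition BMSplus (G : planar_graph) (w : H1 G) (g : compatible w) :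
    digraph :=
  @full_subgraph (BMSgraph w) [set x | fminus x = g].

Definition forget (G : planar_graph) (w : H1 G) (g : compatible w)
  (x : BMSplus g) : Lgraph w := fplus (val x).

(* Main.v *)
(* Edges lying on a connected invisible cycle are frozen: every compatible
   function vanishes on the cycle, so such an edge is never movable.  Nilpotency
   degree zero provides a frozen edge; hence, the medial graph being connected,
   an element g of the component of f is f + delta u for a unique potential u
   vanishing on the frozen edges.  The admissible potentials are cut out by the
   inequalities u(source a) - f(a) <= u(target a), so they are closed under
   pointwise minimum and maximum, and bounded since the medial graph is strongly
   connected.  If u < v are admissible, some edge e with u(e) < v(e) is movable
   at f + delta u: otherwise each such edge has an outgoing arrow on which
   f + delta u vanishes, leading to another such edge, and following these
   arrows closes up an invisible cycle through non-frozen edges.  So reachability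
   is the pointwise order.  For f_- the minimum, the dimension vector of a BMS
   state is the difference of the potentials of f_+ and f_-. *)
Require Import Defs.
From HB Require Import structures.
From mathcomp Require Import all_boot all_order all_algebra.
From mathcomp Require Import boolp classical_sets.
From mathcomp Require Import zify.
(* Restores [half], [next] and [edge], which MathComp shadows. *)
Import Defs.

Set Implicit Arguments.
Unset Strict Implicit.
Unset Printing Implicit Defensive.

Import Order.TTheory GRing.Theory Num.Theory.
Local Open Scope ring_scope.

(** * Digraphs with integer coordinates and their lattice structure *)

(** The laws hold coordinatewise for [min] and [max] on the integers and transfer along the
    injection [r]. *)
Lemma finite_vector_lattice (I T : finType) (r : T -> {ffun I -> int}) :
  injective r ->
  (forall x y, exists z, forall i, r z i = Num.min (r x i) (r y i)) ->
  (forall x y, exists z, forall i, r z i = Num.max (r x i) (r y i)) ->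
  exists (disp : Order.disp_t) (L : finDistrLatticeType disp) (phi : L -> T),
    bijective phi /\
    (forall s t : L, (s <= t)%O <-> forall i, r (phi s) i <= r (phi t) i).
Proof.
move=> r_inj r_min r_max.
have rP x y : (forall i, r x i = r y i) -> x = y.
  by move=> rxy; apply/r_inj/ffunP.
pose meet x y := projT1 (cid (r_min x y)).
pose join x y := projT1 (cid (r_max x y)).
have meetE x y i : r (meet x y) i = Num.min (r x i) (r y i).
  by rewrite /meet; case: cid.
have joinE x y i : r (join x y) i = Num.max (r x i) (r y i).
  by rewrite /join; case: cid.
pose d := Order.Disp tt tt.
(* Defining the order through [meet] makes the order axioms of the structure reflexivities; the
   coordinatewise order is compared with it only at the end. *)
pose le x y := meet x y == x.
pose lt x y := (y != x) && le x y.
have meetC : commutative meet.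
  by move=> x y; apply: rP => i; rewrite !meetE minC.
have joinC : commutative join.
  by move=> x y; apply: rP => i; rewrite !joinE maxC.
have meetA : associative meet.
  by move=> x y z; apply: rP => i; rewrite !meetE minA.
have joinA : associative join.
  by move=> x y z; apply: rP => i; rewrite !joinE maxA.
have joinKI y x : meet x (join x y) = x.
  by apply: rP => i; rewrite !meetE !joinE; lia.
have meetKU y x : join x (meet x y) = x.
  by apply: rP => i; rewrite !joinE !meetE; lia.
have meetUl : left_distributive meet join.
  by move=> x y z; apply: rP => i; rewrite !(joinE, meetE); lia.
have meetxx : idempotent_op meet.
  by move=> x; apply: rP => i; rewrite meetE minxx.
pose m := Order.isMeetJoinDistrLattice.Build d T (fun _ _ => erefl (le _ _))
  (fun _ _ => erefl (lt _ _)) meetC joinC meetA joinA joinKI meetKU meetUl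
  meetxx.
pose L : finDistrLatticeType d := HB.pack T m.
exists d, L, id; split; first by exists id.
move=> s t; rewrite /Order.le /= /le; split=> [/eqP st i|st].
  by rewrite -st meetE; lia.
by apply/eqP/rP => i; rewrite meetE; apply/min_idPl.
Qed.

(* A digraph drawn in Z^I with unit vectors as arrows. *)
Record cubical (D : digraph) (I : finType) (r : D -> {ffun I -> int}) : Prop :=
  Cubical {
    coord_inj : injective r;
    coord_bound : exists B : nat, forall x i, `|r x i| <= B%:Z;
    coord_arrow : forall x y : D,
      arrow x y <-> exists i, r y = [ffun j => r x j + (j == i)%:R];
    coord_min : forall x y, exists z, forall i, r z i = Num.min (r x i) (r y i);
    coord_max : forall x y, exists z, forall i, r z i = Num.max (r x i) (r y i);
    coord_step : forall x y, x <> y -> (forall i, r x i <= r y i) ->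
      exists2 z : D, arrow x z & forall i, r z i <= r y i
  }.

Section Cubical.
Variables (D : digraph) (I : finType) (r : D -> {ffun I -> int}).
Hypothesis rD : cubical r.

Definition coord_rank (x : D) : int := \sum_i r x i.

Lemma coord_rank_arrow (x y : D) : arrow x y -> coord_rank y = coord_rank x + 1.
Proof.
case/(coord_arrow rD) => i ry; rewrite /coord_rank ry.
under eq_bigr do rewrite ffunE.
rewrite big_split /=; congr (_ + _).
by rewrite (bigD1 i) //= eqxx big1 ?addr0 // => j /negPf ->.
Qed.

Lemma coord_rank_le (x y : D) :
  (forall i, r x i <= r y i) -> coord_rank x <= coord_rank y.
Proof. by move=> xy; apply: ler_sum => i _. Qed.

Lemma coord_rank_eq (x y : D) :
  (forall i, r x i <= r y i) -> coord_rank y <= coord_rank x -> x = y.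
Proof.
move=> xy yx; apply/(coord_inj rD)/ffunP => i; apply: le_anti; rewrite xy /=.
rewrite leNgt; apply/negP => ltxy; suff : coord_rank x < coord_rank y by lia.
rewrite /coord_rank (bigD1 i) //= [ltRHS](bigD1 i) //=.
by apply: ltr_leD => //; apply: ler_sum.
Qed.

(** For the converse, [coord_step] moves [x] towards [y] without overshooting, and the rank gap
    drops by one each time. *)
Lemma coord_dpath (x y : D) : dpath x y <-> forall i, r x i <= r y i.
Proof.
split=> [[p]|xy].
  elim: p x => [|z p IHp] x /=; first by move=> _ ->.
  case/andP => /(coord_arrow rD)[j rz] zp ylast i.
  apply: le_trans (IHp z zp ylast i); rewrite rz ffunE.
  by case: eqP; lia.
have [n] : exists n, (`|coord_rank y - coord_rank x| <= n)%N by eexists.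
elim: n x xy => [|n IHn] x xy len.
  exists [::] => //=; apply/esym/coord_rank_eq => //.
  by move: (coord_rank_le xy); lia.
have [<-|neq] := pselect (x = y); first by exists [::].
have [z xz zy] := coord_step rD neq xy.
have [|p zp ylast] := IHn z zy.
  by move: (coord_rank_arrow xz) (coord_rank_le zy); lia.
by exists (z :: p) => //=; rewrite xz.
Qed.

Lemma cubical_lattice : is_finite_graded_distr_lattice D.
Proof.
split; last by exists coord_rank; exact: coord_rank_arrow.
have [B rB] := coord_bound rD.
(* Shifting by [B] puts all coordinates between 0 and [B + B], so [D] is in bijection with a finite
   set of codes. *)
pose enc x : {ffun I -> 'I_(B + B).+1} :=
  [ffun i => inord (absz (r x i + B%:Z))].
pose T : finType := {t | `[< exists x, enc x = t >]}.
have encE x i : (enc x i : int) = r x i + B%:Z.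
  by rewrite ffunE inordK; move: (rB x i); lia.
have enc_inj : injective enc.
  move=> x y exy; apply/(coord_inj rD)/ffunP => i.
  by apply: (addIr B%:Z); rewrite -!encE exy.
have decP (t : T) : exists x, enc x = val t by apply/asboolP; exact: (valP t).
pose dec t := projT1 (cid (decP t)).
have decK t : enc (dec t) = val t by rewrite /dec; case: cid.
have dec_bij : bijective dec.
  have encP x : `[< exists y, enc y = enc x >] by apply/asboolP; exists x.
  exists (fun x => exist _ (enc x) (encP x) : T) => [t|x].
    exact/val_inj/decK.
  exact/enc_inj/decK.
have onto x : exists t, dec t = x by case: dec_bij => f _ fK; exists (f x).
have [||| d [L [phi [phi_bij phiP]]]] := @finite_vector_lattice I T (r \o dec).
- exact: inj_comp (coord_inj rD) (bij_inj dec_bij).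
- move=> s t; have [z zE] := coord_min rD (dec s) (dec t).
  by have [u uz] := onto z; exists u => i /=; rewrite uz.
- move=> s t; have [z zE] := coord_max rD (dec s) (dec t).
  by have [u uz] := onto z; exists u => i /=; rewrite uz.
exists d, L, (dec \o phi); split; first exact: bij_comp.
by move=> s t; rewrite coord_dpath; exact: phiP.
Qed.

(** Boundedness gives an element of least rank; its meet with any [y] lies below it, hence equals
    it. *)
Lemma coord_minimum (x0 : D) : exists x : D, forall y i, r x i <= r y i.
Proof.
have [B rB] := coord_bound rD.
have lb x : - (\sum_(i : I) B%:Z) <= coord_rank x.
  rewrite -sumrN; apply: ler_sum => i _; by move: (rB x i); lia.
(* The shift makes the rank nonnegative, so [absz] preserves its order. *)
pose P n := `[< exists x, absz (coord_rank x + \sum_(i : I) B%:Z) = n >].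
have exP : exists n, P n by eexists; apply/asboolP; exists x0.
have [_ /asboolP[x <-] minx] := ex_minnP exP.
exists x => y; have [z zE] := coord_min rD x y.
have zx i : r z i <= r x i by rewrite zE; lia.
suff -> : x = z by move=> i; rewrite zE; lia.
apply/esym/coord_rank_eq => //.
have : P (absz (coord_rank z + \sum_(i : I) B%:Z)) by apply/asboolP; exists z.
by move/minx; move: (lb x) (lb z); lia.
Qed.

End Cubical.

(** * Connectivity of the medial graph and rigidity of potentials *)

Section MedialGraph.
Variable G : planar_graph.

Lemma next_neq (h : half G) : next h != h.
Proof.
apply/eqP => nh; have := degree_ge2 (endpoint h).
rewrite (@eq_card _ _ (pred1 h)) ?card1 // => h'.
rewrite inE; apply/idP/eqP => [|->]; last by apply/mem_set; exact: eqxx.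
move/set_mem; rewrite /= eq_sym -next_orbit => /iter_findex <-.
by elim: (findex _ _ _) => //= n ->.
Qed.

Lemma edge_of_opp (h : half G) : edge_of (opp h) = edge_of h.
Proof. by apply/esym/eqP; rewrite edge_of_fiber eqxx orbT. Qed.

Lemma endpoint_next (h : half G) : endpoint (next h) = endpoint h.
Proof. by apply/esym/eqP; rewrite -next_orbit fconnect1. Qed.

(** [next] stays at the vertex, whereas the other half of an edge sits at a different vertex. *)
Lemma source_neq_target (a : angle G) : source a != target a.
Proof.
rewrite /source /target edge_of_fiber (negPf (next_neq a)) /=.
by apply: contraNneq (loopless a) => <-; rewrite endpoint_next.
Qed.

Lemma half_connected (h h' : half G) :
  connect [rel x y | (y == next x) || (y == opp x)] h h'.
Proof.
have turn (x y : half G) : endpoint x = endpoint y ->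
    connect [rel x y | (y == next x) || (y == opp x)] x y.
  move=> /eqP; rewrite -next_orbit; apply: connect_sub => {x y} x _ /eqP <-.
  by apply: connect1; rewrite /= eqxx.
have /connectP[p] := graph_connected (endpoint h) (endpoint h').
elim: p h => [|v p IHp] h /=; first by move=> _ /esym; exact: turn.
case/andP => /existsP[k /andP[/eqP kh /eqP kv]] vp last_p.
apply: (connect_trans (turn _ k (esym kh))).
apply: (connect_trans (y := opp k)); last by apply: IHp; rewrite kv.
by apply: connect1; rewrite /= eqxx orbT.
Qed.

(** Strong connectivity in quantitative form: along a repetition-free path of half-edges, [opp]
    keeps the edge and [next] follows an arrow, which costs at most [M]. *)
Lemma potential_bound (M : nat) (u : edge G -> int) :
    (forall a, u (source a) - M%:Z <= u (target a)) ->
  forall e e', u e - (M * #|half G|)%:Z <= u e'.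
Proof.
move=> uM e e'; have [h <-] := edge_of_surj e; have [h' <-] := edge_of_surj e'.
have /connectP[p0 + ->] := half_connected h h'; case/shortenP => p hp p_uniq _.
have p_size : (size p <= #|half G|)%N.
  by rewrite ltnW // -[_.+1]/(size (h :: p)) -(card_uniqP p_uniq) max_card.
suff : u (edge_of h) - (M * size p)%:Z <= u (edge_of (last h p)).
  by apply: le_trans; rewrite lerD2l lerN2 lez_nat leq_mul.
elim: p h hp {p_uniq p_size} => [|k p IHp] h /=; first by rewrite muln0 subr0.
case/andP => hk kp; apply: le_trans (IHp k kp).
rewrite mulnS PoszD opprD addrA lerD2r.
case/orP: hk => /eqP ->; first exact: uM.
by rewrite edge_of_opp lerBlDr lerDl.
Qed.

(** The difference of [u] and [v] is preserved by arrows, so [potential_bound] with [M = 0], applied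
    to it and to its opposite, makes it constant. *)
Lemma delta_inj_at (e0 : edge G) (u v : cochain0 G) :
  delta u = delta v -> u e0 = v e0 -> u = v.
Proof.
move=> duv uv0; apply/ffunP => e.
have uv a : u (target a) - u (source a) = v (target a) - v (source a).
  by move/ffunP/(_ a): duv; rewrite !ffunE.
have le1 : u e0 - v e0 - (0 * #|half G|)%:Z <= u e - v e.
  by apply: (potential_bound (u := fun e => u e - v e)) => a; move: (uv a); lia.
have le2 : v e0 - u e0 - (0 * #|half G|)%:Z <= v e - u e.
  by apply: (potential_bound (u := fun e => v e - u e)) => a; move: (uv a); lia.
move: le1 le2; rewrite mul0n uv0 subrr subr0 !subr_ge0 => le1 le2.
by apply: le_anti; rewrite le1 le2.
Qed.

Lemma deltaD (u v : cochain0 G) : delta (u + v) = delta u + delta v.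
Proof. by apply/ffunP => a; rewrite !ffunE opprD addrACA. Qed.

Lemma addE (u v : cochain0 G) e : (u + v) e = u e + v e.
Proof. by rewrite ffunE. Qed.

End MedialGraph.

(** * Invisible cycles and frozen edges *)

Definition frozen (G : planar_graph) (w : H1 G) (e : edge G) : Prop :=
  exists c, [/\ invisible_cycle w c, connected_cycle c & belongs_to e c].

Section Frozen.
Variables (G : planar_graph) (w : H1 G) (g : compatible w).

Lemma compatible_ge0 a : 0 <= val g a.
Proof. by case/andP: (valP g) => /forallP/(_ a). Qed.

Lemma compatible_class : coh_class (val g) = w.
Proof. by case/andP: (valP g) => _ /eqP. Qed.

Lemma compatible_shift (u : cochain0 G) :
  nonneg (val g + delta u) -> exists h : compatible w, val h = val g + delta u.
Proof.
move=> gu.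
have gP : nonneg (val g + delta u) && (coh_class (val g + delta u) == w).
  rewrite gu /=; apply/eqP; rewrite -[RHS]compatible_class.
  by apply/coh_class_eqP; exists u.
by exists (exist _ (val g + delta u) gP).
Qed.

Lemma invisible_zero c a : invisible_cycle w c -> c a != 0 -> val g a = 0.
Proof.
case=> -[c0 /forallP c_ge0] _; rewrite (lambdaE c0 compatible_class) => /eqP.
rewrite psumr_eq0 => [/allP/(_ a (mem_index_enum a))|b _]; last first.
  by rewrite mulr_ge0 ?compatible_ge0.
by rewrite mulf_eq0 => /orP[/eqP->|/eqP->]; rewrite ?eqxx.
Qed.

(** Zero boundary balances inflow and outflow at [e], so a positive inflow forces an outgoing arrow
    of the cycle. *)
Lemma cycle_out (c : chain1 G) e :
  angular_cycle c -> belongs_to e c -> exists2 a, source a = e & c a != 0.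
Proof.
case=> /ffunP/(_ e); rewrite !ffunE => /eqP; rewrite subr_eq0 => /eqP bal.
move=> /forallP c_ge0 /existsP[a /andP[ca /orP[/eqP ae|/eqP ae]]].
  by exists a.
have : 0 < \sum_(b | source b == e) c b.
  rewrite -bal (bigD1 a) ?ae //= ltr_wpDr ?sumr_ge0 //.
  by rewrite lt_neqAle eq_sym ca c_ge0.
rewrite lt_neqAle eq_sym psumr_neq0 // => /andP[/hasP[b _ /andP[/eqP be cb]] _].
by exists b; rewrite // gt_eqF.
Qed.

(** The move would lower [g] by one on an arrow leaving [e] where it is already zero. *)
Lemma frozen_not_movable e : frozen w e -> ~~ movable e (val g).
Proof.
move=> [c [c_inv _ ec]]; have [c_cyc _ _] := c_inv.
have [a ae ca] := cycle_out c_cyc ec.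
apply/negP => /forallP/(_ a); rewrite !ffunE (invisible_zero c_inv ca) add0r.
by rewrite -ae eqxx eq_sym (negPf (source_neq_target a)).
Qed.

Lemma not_movable_zero e :
  ~~ movable e (val g) -> exists2 a, source a = e & val g a = 0.
Proof.
move=> /forallPn[a]; rewrite !ffunE -ltNge.
have ga_ge0 := compatible_ge0 a.
have := source_neq_target a; have [<-|_ _] := eqVneq (source a) e.
  rewrite eq_sym => /negPf ->; rewrite sub0r subr_lt0 -[1]add0r ltzD1 => ga_le0.
  by exists a => //; apply: le_anti; rewrite ga_le0.
by rewrite subr0 ltNge addr_ge0.
Qed.

(* Following, inside S, arrows on which g vanishes ends in a directed cycle,
   which is an invisible cycle. *)
Lemma zero_arrows_frozen (S : pred (edge G)) :
    (forall e, S e ->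
       exists a, [/\ source a = e, S (target a) & val g a = 0]) ->
  (exists e, S e) -> exists2 e, S e & frozen w e.
Proof.
move=> S_out [e0 Se0].
have /choice[out outP] : forall e, exists a,
    source a = e /\ (S e -> S (target a) /\ val g a = 0).
  move=> e; have [/S_out[a [ae Sa ga]]|nS] := boolP (S e); first by exists a.
  (* Outside [S] any arrow leaving [e] serves, only to make [out] total. *)
  by have [h he] := edge_of_surj e; exists h.
pose nx e := target (out e).
have S_iter e i : S e -> S (iter i nx e).
  by move=> Se; elim: i => //= i /(outP _).2[].
have [x Sx [n nxx]] : exists2 x, S x & exists n, iter n.+1 nx x = x.
  (* After [order] steps the orbit of [e0] is back at its [i]-th iterate, which thus returns to
     itself after [order - i] steps, a positive number. *)
  have /trajectP[i lt_i eq_i] := looping_order nx e0.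
  exists (iter i nx e0); first exact: S_iter.
  exists (fingraph.order nx e0 - i).-1; rewrite -iterD.
  by rewrite prednK ?subn_gt0 // subnK // ltnW.
(* [c a] counts the passages through [a] of the closed walk of length [n.+1] from [x]. *)
pose c : chain1 G := [ffun a => \sum_(i < n.+1) (a == out (iter i nx x))%:R].
have c_ge0 : nonneg c.
  by apply/forallP => a; rewrite ffunE sumr_ge0.
have c_sub a : c a != 0 -> exists i, a = out (iter i nx x).
  rewrite ffunE => ca; apply: contrapT => na; case/negP: ca.
  by rewrite big1 // => i _; case: eqP => // ai; case: na; exists i.
have c_out i : c (out (iter i nx x)) != 0.
  have /trajectP[j lt_j ->] : iter i nx x \in traject nx x n.+1.
    by apply/loopingP; rewrite /looping nxx mem_head.
  rewrite ffunE (bigD1 (Ordinal lt_j)) //= eqxx gt_eqF //.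
  by rewrite ltr_wpDr ?sumr_ge0.
have sumE (P : pred (angle G)) :
    \sum_(a | P a) c a = \sum_(i < n.+1) (P (out (iter i nx x)))%:R.
  under eq_bigr do rewrite ffunE.
  rewrite exchange_big; apply: eq_bigr => i _ /=.
  rewrite big_mkcond (bigD1 (out (iter i nx x))) //= eqxx big1.
    by rewrite addr0; case: (P _).
  by move=> a /negPf ->; case: ifP.
have c_cyc : angular_cycle c.
  split=> //; apply/ffunP => e; rewrite !ffunE !sumE -sumrB.
  (* Each step leaves one edge and enters the next, so the boundary telescopes around the closed
     walk. *)
  under eq_bigr do rewrite (outP _).1 -[target _]/(iter _.+1 nx x).
  rewrite -(big_mkord xpredT
    (fun i => (iter i.+1 nx x == e)%:R - (iter i nx x == e)%:R : int)).
  by rewrite telescope_sumr // nxx subrr.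
have c_vertex e : belongs_to e c -> exists i, e = iter i nx x.
  case/existsP => a /andP[/c_sub[i ->]]; rewrite (outP _).1.
  by case/orP => /eqP <-; [exists i | exists i.+1].
exists x => //; exists c; split.
- split=> //.
    by apply/eqP => c0; move: (c_out 0%N); rewrite c0 ffunE eqxx.
  rewrite (lambdaE c_cyc.1 compatible_class) big1 // => a _.
  have [->|/c_sub[i ->]] := eqVneq (c a) 0; first by rewrite mul0r.
  by rewrite ((outP _).2 _).2 ?mulr0 //; exact: S_iter.
- move=> _ _ /c_vertex[i ->] /c_vertex[j ->].
  set R := [rel _ _ | _].
  have R_sym : connect_sym R.
    by apply: sym_connect_sym => y z /=; apply: eq_existsb => a; rewrite orbC.
  have Rx k : connect R x (iter k nx x).
    elim: k => [|k IHk]; first exact: connect0.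
    apply: connect_trans IHk (connect1 _); apply/existsP.
    by exists (out (iter k nx x)); rewrite c_out (outP _).1 !eqxx.
  by apply: connect_trans (Rx j); rewrite R_sym.
- by apply/existsP; exists (out x); rewrite (c_out 0%N) (outP x).1 eqxx.
Qed.

(** The given invisible cycle may be disconnected, but [g] vanishes on its arrows, and following
    them yields a connected one. *)
Lemma frozen_exists : nilpotency_degree_zero w -> exists e, frozen w e.
Proof.
case=> -[c [c_cyc c_neq0 c_zero]] _.
have c_inv : invisible_cycle w c by [].
have [||e _ fe] := zero_arrows_frozen (S := fun e => belongs_to e c).
- move=> e /(cycle_out c_cyc)[a ae ca]; exists a; split=> //.
    by apply/existsP; exists a; rewrite ca eqxx orbT.
  exact: invisible_zero c_inv ca.
- have [a ca] : exists a, c a != 0.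
    apply: contrapT => nc; case/eqP: c_neq0; apply/ffunP => a; rewrite ffunE.
    by apply/eqP/negPn/negP => ca; apply: nc; exists a.
  by exists (source a); apply/existsP; exists a; rewrite ca eqxx.
by exists e.
Qed.

End Frozen.

(** * The component of [f] as a lattice of admissible potentials *)

Section Component.
Variables (G : planar_graph) (w : H1 G).
Hypothesis w_nil : nilpotency_degree_zero w.
Variable f : Lgraph w.

Let f_c : compatible w := f.

(** The second clause is the nonnegativity of [f + delta u], put as difference constraints that
    [min] and [max] preserve. *)
Definition admissible (u : cochain0 G) : Prop :=
  (forall e, frozen w e -> u e = 0) /\
  (forall a, u (source a) - val f_c a <= u (target a)).

Definition shifts : set (Lgraph w) :=
  [set g : Lgraph w | exists2 u, admissible u &
     val (g : compatible w) = val f_c + delta u]%classic.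

Lemma nonneg_shift (u : cochain0 G) :
  nonneg (val f_c + delta u) <->
  (forall a, u (source a) - val f_c a <= u (target a)).
Proof.
have E a : (0 <= (val f_c + delta u) a) =
    (u (source a) - val f_c a <= u (target a)).
  by rewrite !ffunE addrA subr_ge0 lerBlDl.
split=> [/forallP u_ge0 a|u_le]; last (apply/forallP => a).
  by rewrite -E.
by rewrite E.
Qed.

Lemma admissible_shift (u : cochain0 G) :
  admissible u -> exists2 g : Lgraph w, shifts g &
    val (g : compatible w) = val f_c + delta u.
Proof.
move=> uP; have [|g gu] := @compatible_shift _ _ f_c u.
  by apply/nonneg_shift; case: uP.
by exists g; [exists u|].
Qed.

Lemma frozen_delta_inj (u v : cochain0 G) :
    (forall e, frozen w e -> u e = v e) -> delta u = delta v -> u = v.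
Proof.
have [e0 e0_frozen] := frozen_exists f_c w_nil.
by move=> uv duv; apply: (delta_inj_at duv (uv e0 e0_frozen)).
Qed.

Lemma shift_potential_exists (x : full_subgraph shifts) :
  exists u, admissible u /\ val (val x : compatible w) = val f_c + delta u.
Proof. by have [u ? ?] := set_mem (valP x); exists u. Qed.

Definition potential (x : full_subgraph shifts) : cochain0 G :=
  projT1 (cid (shift_potential_exists x)).

Lemma potential_admissible x : admissible (potential x).
Proof. by rewrite /potential; case: cid => u []. Qed.

Lemma val_potential (x : full_subgraph shifts) :
  val (val x : compatible w) = val f_c + delta (potential x).
Proof. by rewrite /potential; case: cid => u []. Qed.

Lemma potential_eq (x : full_subgraph shifts) (u : cochain0 G) :
    (forall e, frozen w e -> u e = 0) ->
  val (val x : compatible w) = val f_c + delta u -> potential x = u.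
Proof.
move=> u0; rewrite val_potential => /addrI; apply: frozen_delta_inj => e fe.
by rewrite (potential_admissible x).1 ?u0.
Qed.

Lemma potential_onto (u : cochain0 G) :
  admissible u -> exists x, potential x = u.
Proof.
move=> uP; have [g g_shift gu] := admissible_shift uP.
exists (exist _ g (mem_set g_shift) : full_subgraph shifts).
by apply: potential_eq => //; case: uP.
Qed.

Lemma potential_inj : injective potential.
Proof.
by move=> x y xy; apply/val_inj/val_inj; rewrite !val_potential xy.
Qed.

Lemma movable_not_frozen e (g : compatible w) :
  movable e (val g) -> ~ frozen w e.
Proof. by move=> mg fe; move: (frozen_not_movable g fe); rewrite mg. Qed.

Lemma chi_frozen e e' (g : compatible w) :
  movable e (val g) -> frozen w e' -> chi e e' = 0.
Proof.
move=> mg fe'; rewrite ffunE; case: eqP => // ee'.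
by case: (movable_not_frozen mg); rewrite -ee'.
Qed.

(** A movable edge is not frozen, so adding [chi e] keeps the potential zero on frozen edges and
    uniqueness applies. *)
Lemma potential_mov (x y : full_subgraph shifts) e :
    movable e (val (val x : compatible w)) ->
    val (val y : compatible w) = mov e (val (val x : compatible w)) ->
  potential y = potential x + chi e.
Proof.
move=> mx yx; apply: potential_eq => [e' fe'|].
  by rewrite addE (chi_frozen mx fe') (potential_admissible x).1.
by rewrite deltaD addrA -val_potential yx.
Qed.

Lemma potential_arrow (x y : full_subgraph shifts) :
  arrow x y <-> exists e, potential y = potential x + chi e.
Proof.
split=> [/existsP[e /andP[mx /eqP yx]]|[e yx]].
  by exists e; apply: potential_mov.
have ymov : val (val y : compatible w) = mov e (val (val x : compatible w)).
  by rewrite /mov !val_potential yx deltaD addrA.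
apply/existsP; exists e; rewrite ymov eqxx andbT.
(* Movability of [e] at [x] is the nonnegativity of [y]. *)
by rewrite /movable -[_ + _]ymov; apply/forallP; exact: compatible_ge0.
Qed.

Lemma potential_step (x y : full_subgraph shifts) :
    x <> y -> (forall e, potential x e <= potential y e) ->
  exists2 z, arrow x z & forall e, potential z e <= potential y e.
Proof.
move=> neq_xy le_xy; pose S e := potential x e < potential y e.
have notS e : ~~ S e -> potential y e = potential x e.
  by rewrite -leNgt => ge; apply: le_anti; rewrite ge le_xy.
have [e Se ex] : exists2 e, S e & movable e (val (val x : compatible w)).
  apply: contrapT => noS.
  have [||e Se fe] := @zero_arrows_frozen _ _ (val x : compatible w) S.
  - move=> e Se.
    have [|a ae xa] := @not_movable_zero _ _ (val x : compatible w) e.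
      by apply/negP => me; apply: noS; exists e.
    exists a; split=> //; rewrite /S.
    (* A zero arrow is a tight constraint for [x], so the strict gap at its source passes to its
       target. *)
    apply: lt_le_trans ((potential_admissible y).2 a).
    move: xa; rewrite val_potential !ffunE => /eqP.
    rewrite addrA subr_eq0 => /eqP xa.
    by rewrite -(ltrD2l (val f_c a)) xa addrCA subrr addr0 ae.
  - apply: contrapT => nS; apply/neq_xy/potential_inj/ffunP => e.
    by apply/esym/notS/negP => Se; apply: nS; exists e.
  (* Both potentials vanish on frozen edges, so [S] contains none. *)
  by move: Se; rewrite /S !(potential_admissible _).1 // ltxx.
have [|z zE] := @potential_onto (potential x + chi e).
  split=> [e' fe'|].
    by rewrite addE (chi_frozen ex fe') (potential_admissible x).1.
  by apply/nonneg_shift; rewrite deltaD addrA -val_potential.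
exists z; first by apply/potential_arrow; exists e.
move=> e'; rewrite zE addE [chi _ _]ffunE.
by have [->|_] := eqVneq e' e; [rewrite lezD1|rewrite addr0].
Qed.

Lemma potential_bounded :
  exists B : nat, forall x e, `|potential x e| <= B%:Z.
Proof.
have [e0 e0_frozen] := frozen_exists f_c w_nil.
pose M := absz (\sum_a val f_c a); exists (M * #|half G|)%N => x e.
have fM a : val f_c a <= M%:Z.
  rewrite /M gez0_abs ?sumr_ge0 // => [|b _]; last exact: compatible_ge0.
  rewrite (bigD1 a) //= lerDl sumr_ge0 // => b _; exact: compatible_ge0.
have xM a : potential x (source a) - M%:Z <= potential x (target a).
  by apply: le_trans ((potential_admissible x).2 a); rewrite lerD2l lerN2.
have := potential_bound xM e0 e; have := potential_bound xM e e0.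
rewrite ((potential_admissible x).1 e0) // sub0r lerBlDr add0r => ub lb.
by rewrite ler_norml lb ub.
Qed.

Lemma potential_cubical : cubical potential.
Proof.
split.
- exact: potential_inj.
- exact: potential_bounded.
- move=> x y; rewrite potential_arrow.
  by split=> -[e yx]; exists e; rewrite yx; apply/ffunP => e'; rewrite !ffunE.
- move=> x y.
  have [|z zE] := @potential_onto
    [ffun e => Num.min (potential x e) (potential y e)].
    split=> [e fe|a]; rewrite !ffunE.
      by rewrite !(potential_admissible _).1 // minxx.
    move: ((potential_admissible x).2 a) ((potential_admissible y).2 a).
    by rewrite le_min lerBlDr !minElt; case: ifP; lia.
  by exists z => e; rewrite zE ffunE.
- move=> x y.
  have [|z zE] := @potential_onto
    [ffun e => Num.max (potential x e) (potential y e)].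
    split=> [e fe|a]; rewrite !ffunE.
      by rewrite !(potential_admissible _).1 // maxxx.
    move: ((potential_admissible x).2 a) ((potential_admissible y).2 a).
    by lia.
  by exists z => e; rewrite zE ffunE.
- exact: potential_step.
Qed.

Lemma shiftsI (g : Lgraph w) (u : cochain0 G) :
    (forall e, frozen w e -> u e = 0) ->
  val (g : compatible w) = val f_c + delta u -> shifts g.
Proof.
move=> u0 gu; exists u => //; split=> //; apply/nonneg_shift; rewrite -gu.
by apply/forallP; exact: compatible_ge0.
Qed.

Lemma shifts_refl : shifts f.
Proof.
apply: (@shiftsI _ 0) => [e _|]; first by rewrite ffunE.
by rewrite -[X in delta X](subrr 0) deltaB subrr addr0.
Qed.

Lemma dpath_component (A : set (Lgraph w)) (x y : full_subgraph A) :
  dpath x y -> component (val x) (val y) /\ component (val y) (val x).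
Proof.
set E := [rel u v : Lgraph w | arrow u v || arrow v u].
case=> p xp ->; have pE : path E (val x) (map val p).
  rewrite path_map; apply: sub_path xp => u v /= uv.
  by apply/orP; left.
split; first by exists (map val p); rewrite ?last_map.
exists (rev (belast (val x) (map val p))).
  rewrite -last_map rev_path; apply: sub_path pE => u v /=; by rewrite orbC.
by case: (p) => //= z q; rewrite rev_cons last_rcons.
Qed.

Lemma component_trans (g h k : Lgraph w) :
  component g h -> component h k -> component g k.
Proof.
case=> p gp -> [q hq ->]; exists (p ++ q); last by rewrite last_cat.
by rewrite cat_path gp.
Qed.

Lemma component_shifts : component f = shifts.
Proof.
apply/seteqP; split=> g.
  case=> p + ->; elim/last_ind: p => [_|p h IHp]; first exact: shifts_refl.
  rewrite rcons_path last_rcons => /andP[/IHp[u [u0 uP] lu]].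
  case/orP => /existsP[e /andP[me /eqP he]].
    apply: (@shiftsI _ (u + chi e)) => [e' fe'|].
      by rewrite addE (chi_frozen me fe') u0.
    by rewrite he /mov lu deltaD addrA.
  apply: (@shiftsI _ (u - chi e)) => [e' fe'|].
    by rewrite addE u0 // ffunE (chi_frozen me fe') oppr0.
  by rewrite deltaB addrA -lu he /mov addrK.
move=> g_shift.
pose x : full_subgraph shifts := exist _ f (mem_set shifts_refl).
pose y : full_subgraph shifts := exist _ g (mem_set g_shift).
have [z zE] := coord_min potential_cubical x y.
(* [f] and [g] are linked through their meet [z], from which directed paths lead to both. *)
have /dpath_component[_ fz] : dpath z x.
  by apply/(coord_dpath potential_cubical) => e; rewrite zE ge_min lexx.
have /dpath_component[zg _] : dpath z y.
  by apply/(coord_dpath potential_cubical) => e; rewrite zE ge_min lexx orbT.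
exact: component_trans fz zg.
Qed.

(** * BMS states over the minimum *)

Lemma bms_inj (x y : bms_state w) :
  fplus x = fplus y -> fminus x = fminus y -> dimv x = dimv y -> x = y.
Proof.
case: x y => [p m d b v] [p' m' d' b' v'] /= pp mm dd; subst p' m' d'.
by congr BMSState; exact: Prop_irrelevance.
Qed.

Lemma bms_dim_frozen (x : bms_state w) e : frozen w e -> dimv x e = 0%N.
Proof. by case=> c [c_inv c_con ec]; exact: bms_vanish c_inv c_con ec. Qed.

Section Minimum.
Variable m : full_subgraph shifts.
Hypothesis m_min : forall y e, potential m e <= potential y e.

Lemma bms_shifts (x : BMSplus (val m : compatible w)) : shifts (forget x).
Proof.
have xm : fminus (val x) = val m := set_mem (valP x).
apply: (@shiftsI _ (potential m + [ffun e => (dimv (val x) e)%:Z])) => [e fe|].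
  by rewrite addE (potential_admissible m).1 // ffunE bms_dim_frozen.
by rewrite /forget bms_weak xm val_potential deltaD addrA.
Qed.

Definition bms_shift (x : BMSplus (val m : compatible w)) :
    full_subgraph shifts :=
  exist _ (forget x) (mem_set (bms_shifts x)).

(** The dimension vector vanishes on frozen edges, so uniqueness of potentials identifies it with
    the gap above [m]. *)
Lemma bms_shift_potential x :
  potential (bms_shift x) = potential m + [ffun e => (dimv (val x) e)%:Z].
Proof.
have xm : fminus (val x) = val m := set_mem (valP x).
apply: potential_eq => [e fe|].
  by rewrite addE (potential_admissible m).1 // ffunE bms_dim_frozen.
by rewrite /= /forget bms_weak xm val_potential deltaD addrA.
Qed.

Lemma bms_shift_inj : injective bms_shift.
Proof.
move=> x y xy; apply/val_inj/bms_inj.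
- by move/(congr1 val): xy.
- by rewrite [LHS](set_mem (valP x)) [RHS](set_mem (valP y)).
move/(congr1 potential): xy; rewrite !bms_shift_potential => /addrI xy.
by apply/ffunP => e; move/ffunP/(_ e): xy; rewrite !ffunE => -[].
Qed.

Lemma bms_shift_onto y : exists x, bms_shift x = y.
Proof.
(* Minimality of [m] makes these differences nonnegative, so [absz] loses nothing. *)
pose d : {ffun edge G -> nat} :=
  [ffun e => absz (potential y e - potential m e)].
have dE : [ffun e => (d e)%:Z] = potential y - potential m.
  by apply/ffunP => e; rewrite !ffunE gez0_abs // subr_ge0.
have weak : val (val y : compatible w) =
    val (val m : compatible w) + delta [ffun e => (d e)%:Z].
  by rewrite dE deltaB !val_potential addrA addrAC addrK.
have vanish e c : invisible_cycle w c -> connected_cycle c -> belongs_to e c ->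
    d e = 0%N.
  move=> c_inv c_con ec; have fe : frozen w e by exists c.
  by rewrite ffunE !(potential_admissible _).1 // subrr.
pose x : BMSgraph w := BMSState weak vanish.
have xP : x \in [set x : BMSgraph w | fminus x = val m]%classic.
  exact/mem_set.
by exists (exist _ x xP); apply: val_inj.
Qed.

Lemma bms_shift_arrow x y : arrow x y = arrow (bms_shift x) (bms_shift y).
Proof.
have xm : fminus (val x) = val m := set_mem (valP x).
have ym : fminus (val y) = val m := set_mem (valP y).
apply/existsP/existsP => -[e /=].
  by case/and4P=> mx yx _ _; exists e; rewrite mx.
case/andP=> mx yx; exists e; rewrite mx yx xm ym eqxx /=.
(* A BMS arrow also prescribes the change of dimension vector; uniqueness of potentials forces it to
   be [chi e]. *)
have := @potential_mov (bms_shift x) (bms_shift y) e mx (eqP yx).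
rewrite !bms_shift_potential -addrA => /addrI xy.
apply/eqP/ffunP => e'; move/ffunP/(_ e'): xy; rewrite !ffunE natz -PoszD.
by case.
Qed.

End Minimum.

Lemma shifts_lattice : is_finite_graded_distr_lattice (full_subgraph shifts).
Proof. exact: cubical_lattice potential_cubical. Qed.

Lemma shifts_bms :
    exists (m : Lgraph w) (phi : BMSplus m -> full_subgraph shifts),
  (forall x, val (phi x) = forget x) /\ digraph_iso phi.
Proof.
have [m m_min] := coord_minimum potential_cubical
  (exist _ f (mem_set shifts_refl) : full_subgraph shifts).
exists (val m), (@bms_shift m); split=> //; split; last exact: bms_shift_arrow.
have /choice[g gK] := bms_shift_onto m_min.
by exists g => [x|//]; apply: bms_shift_inj; rewrite gK.
Qed.

End Component.

Theorem theorem3p22 (G : planar_graph) (w : H1 G) :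
  nilpotency_degree_zero w ->
  (forall f : Lgraph w,
     is_finite_graded_distr_lattice (full_subgraph (component f))) /\
  (forall f : Lgraph w, exists f_minus : Lgraph w,
     exists phi : BMSplus f_minus -> full_subgraph (component f),
       (forall x : BMSplus f_minus, val (phi x) = forget x) /\
       digraph_iso phi).
Proof.
move=> w_nil; split=> f; rewrite component_shifts //.
  exact: shifts_lattice.
exact: shifts_bms.
Qed.
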